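(* If $K\subset\mathbb R^n$ is a convex body (not necessarily a generating set), then the Carathéodory number for $K$-strong convexity is at least $n$.
   Context: A convex body in $\mathbb R^n$ is a compact convex set with non-empty interior. For sets $K,T\subset\mathbb R^n$ write $$K \ominus T := \bigcap_{t\in T}(K-t).$$ A convex body $K$ is called a generating set if for every non-empty $T\subset\mathbb R^n$ with $K\ominus T\ne\emptyset$ there is a non-empty compact convex set $T'$ with $(K\ominus T)+T'=K$ (Minkowski sum); this property is not assumed here. A set is $K$-strongly convex if it is an intersection of translates of $K$, i.e. of the form $K\ominus T$. For a set $X$ contained in some translate of $K$, its $K$-strongly convex hull is the minimal $K$-strongly convex set containing $X$; it is given by $\operatorname{conv}_K X = K\ominus(K\ominus X)$, i.e. it is the intersection of all translates of $K$ containing $X$ (with $\operatorname{conv}_K\emptyset=\emptyset$). The Carathéodory number for $K$-strong convexity is the minimal integer $m$ such that $$\operatorname{conv}_K (X) = \bigcup_{Y\subseteq X,\ |Y|\le m} \operatorname{conv}_K (Y)$$ for every finite point set $X\subset\mathbb R^n$ contained in a translate of $K$ (it is infinite if no such $m$ exists). *)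

(* Defs.v *)
From mathcomp Require Import all_boot all_order all_algebra.
From mathcomp Require Import all_classical all_reals all_analysis.

Set Implicit Arguments.
Unset Strict Implicit.
Unset Printing Implicit Defensive.

Import Order.TTheory GRing.Theory Num.Theory.
Import numFieldNormedType.Exports.

Local Open Scope classical_set_scope.
Local Open Scope ring_scope.

Definition convex_body (R : realType) (n : nat) (K : set 'rV[R]_n) : Prop :=
  [/\ compact K, convex_set K & K° !=set0].

(** [K ⊖ T]; it is the whole space when [T] is empty. *)
Definition minkowski_diff (R : realType) (n : nat) (K T : set 'rV[R]_n) :
    set 'rV[R]_n :=
  \bigcap_(t in T) [set x - t | x in K].

Definition in_translate (R : realType) (n : nat) (K X : set 'rV[R]_n) : Prop :=
  exists t : 'rV[R]_n, X `<=` [set x + t | x in K].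

(** The conjunct [X !=set0] is the convention [conv_K set0 = set0].  For a
    bounded [K] and [0 < n] it is redundant, as [K ⊖ (K ⊖ set0) = K ⊖ setT] is
    then empty.  Only meaningful when [in_translate K X]. *)
Definition strongly_convex_hull (R : realType) (n : nat)
    (K X : set 'rV[R]_n) : set 'rV[R]_n :=
  [set x | X !=set0 /\ minkowski_diff K (minkowski_diff K X) x].

Definition caratheodory_property (R : realType) (n : nat)
    (K : set 'rV[R]_n) (m : nat) : Prop :=
  forall X : set 'rV[R]_n, finite_set X -> in_translate K X ->
    strongly_convex_hull K X =
    \bigcup_(Y in [set Y | Y `<=` X /\ (Y #<= `I_m)%card]) strongly_convex_hull K Y.

(** An infimum of natural numbers, hence a minimum unless no [m] has the
    property, in which case it is [+oo]. *)
Definition caratheodory_number (R : realType) (n : nat) (K : set 'rV[R]_n) :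
    \bar R :=
  ereal_inf [set (m%:R)%:E | m in caratheodory_property K].

(* Main.v *)
(** Call [a] a smooth normal of [K] if it is the outer normal at a boundary
    point [p] at which [K] looks like the half-space [dot a v < 0] to first
    order.  The smooth normals span: for [u <> 0], inflate around an interior
    point of [K] an ellipsoid that is very long in the direction [u], until it
    touches the boundary of [K].  As [K] is bounded, the ellipsoid cannot touch
    at a point orthogonal to [u], and its normal at the contact point is a
    smooth normal that is not orthogonal to [u].
    Take [n] linearly independent smooth normals [a_i], the dual basis [x_j] and
    [X = {e x_j}] with [e] small.  The barycentre of [X] lies in the hull of [X],
    but [a_i] separates it from the [e x_j] with [j <> i], and for small [e] a
    translate of [K] does the same.  So no proper subset of [X] suffices. *)
Require Import Defs.
From mathcomp Require Import all_boot all_order all_algebra.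
From mathcomp Require Import all_classical all_reals all_analysis.
From mathcomp Require Import ring lra.

Set Implicit Arguments.
Unset Strict Implicit.
Unset Printing Implicit Defensive.

Import Order.TTheory GRing.Theory Num.Theory.
Import numFieldNormedType.Exports.

Local Open Scope classical_set_scope.
Local Open Scope ring_scope.

(** * The Euclidean inner product on row vectors *)

Definition dot (R : realType) (n : nat) (a b : 'rV[R]_n) : R :=
  \sum_i a 0 i * b 0 i.

Section Dot.
Variables (R : realType) (n : nat).
Implicit Types a b c : 'rV[R]_n.

Lemma dotC a b : dot a b = dot b a.
Proof. by apply: eq_bigr => i _; rewrite mulrC. Qed.

Lemma dotDr a b c : dot a (b + c) = dot a b + dot a c.
Proof. by rewrite -big_split; apply: eq_bigr => i _; rewrite mxE mulrDr. Qed.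

Lemma dotZr k a b : dot a (k *: b) = k * dot a b.
Proof. by rewrite mulr_sumr; apply: eq_bigr => i _; rewrite mxE mulrCA. Qed.

Lemma dotNr a b : dot a (- b) = - dot a b.
Proof. by rewrite -scaleN1r dotZr mulN1r. Qed.

Lemma dotDl a b c : dot (a + b) c = dot a c + dot b c.
Proof. by rewrite dotC dotDr !(dotC c). Qed.

Lemma dotZl k a b : dot (k *: a) b = k * dot a b.
Proof. by rewrite dotC dotZr dotC. Qed.

Lemma dotNl a b : dot (- a) b = - dot a b.
Proof. by rewrite dotC dotNr dotC. Qed.

Lemma dot_sumr a (I : finType) (f : I -> 'rV[R]_n) :
  dot a (\sum_i f i) = \sum_i dot a (f i).
Proof.
apply: (big_morph _ (dotDr a)).
by rewrite /dot big1// => i _; rewrite mxE mulr0.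
Qed.

Lemma dot_mulmx a b : a *m b^T = (dot a b)%:M.
Proof.
apply/matrixP => i j; rewrite !ord1 !mxE eqxx mulr1n.
by apply: eq_bigr => k _; rewrite mxE.
Qed.

(** The norm is the sup norm, attained at some coordinate, whose square is one of the terms of
    [dot a a]. *)
Lemma sqr_norm_le_dot a : `|a| ^+ 2 <= dot a a.
Proof.
have [a0|/mx_norm_neq0[[i j] /= aE]] := eqVneq `|a| 0.
  by rewrite a0 expr0n sumr_ge0// => i _; rewrite -expr2 sqr_ge0.
rewrite [`|a|]aE real_normK ?num_real// ord1 /dot (bigD1 j)//= -expr2.
by rewrite lerDl sumr_ge0// => k _; rewrite -expr2 sqr_ge0.
Qed.

Lemma dot_gt0 a : a != 0 -> 0 < dot a a.
Proof.
move=> a0; apply: lt_le_trans (sqr_norm_le_dot a).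
by rewrite exprn_gt0// normr_gt0.
Qed.

Lemma dot_ge0 a : 0 <= dot a a.
Proof. exact: le_trans (sqr_ge0 _) (sqr_norm_le_dot a). Qed.

Lemma cauchy_schwarz a b : b != 0 -> dot a b ^+ 2 <= dot a a * dot b b.
Proof.
(* The square of this vector is [dot b b * (dot a a * dot b b - dot a b ^+ 2)]. *)
move=> /dot_gt0 b0; have := dot_ge0 (dot b b *: a - dot a b *: b).
rewrite !(dotDl, dotDr, dotNl, dotNr, dotZl, dotZr) (dotC b a) => h.
rewrite -subr_ge0 -(pmulr_rge0 _ b0); apply: le_trans h _.
by rewrite le_eqVlt; apply/orP; left; apply/eqP; ring.
Qed.

Lemma continuous_dot (T : topologicalType) (f g : T -> 'rV[R]_n) :
  continuous f -> continuous g -> continuous (fun x => dot (f x) (g x)).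
Proof.
move=> cf cg; rewrite /dot.
elim: (index_enum _) => [|i s IH].
  under eq_fun do rewrite big_nil.
  exact: cst_continuous.
under eq_fun do rewrite big_cons.
move=> x; apply: cvgD; last exact: IH.
have coord (h : T -> 'rV[R]_n) : continuous h -> {for x, continuous (fun y => h y 0 i)}.
  by move=> ch; apply: (@continuous_comp _ _ _ h (fun M => M 0 i) x (ch x)); exact: coord_continuous.
by apply: cvgM; exact: coord.
Qed.

End Dot.

(** * Convexity, continuity and Minkowski differences *)

Lemma convex_combination (R : realType) (n : nat) (K : set 'rV[R]_n) t x y :
  convex_set K -> 0 <= t <= 1 -> K x -> K y -> K (t *: x + (1 - t) *: y).
Proof.
move=> Kcvx /andP[t0 t1] Kx Ky.
have := Kcvx x y (Itv01 t0 t1); rewrite !inE; exact.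
Qed.

Lemma convex_mean (R : realType) (n k : nat) (K : set 'rV[R]_n) (f : 'I_k.+1 -> 'rV[R]_n) :
  convex_set K -> (forall i, K (f i)) -> K (k.+1%:R^-1 *: \sum_i f i).
Proof.
move=> Kcvx; elim: k => [|k IH] in f * => Kf.
  by rewrite big_ord1 invr1 scale1r; exact: Kf.
rewrite big_ord_recr/= addrC scalerDr.
set S := \sum_(i < k.+1) _.
have -> : k.+2%:R^-1 *: S = (1 - k.+2%:R^-1) *: (k.+1%:R^-1 *: S).
  rewrite scalerA; congr (_ *: _).
  rewrite -(natr1 k.+1); have : 0 < k.+1%:R :> R by rewrite ltr0n.
  by move: k.+1%:R => r r0; field; rewrite !gt_eqF// ltr_wpDr.
apply: convex_combination => //; last by apply: IH => i; exact: Kf.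
by rewrite invr_ge0 ler0n/= invf_le1 ?ler1n ?ltr0n.
Qed.

Lemma affine_continuous (R : realType) (V : normedModType R) (k : R) (b : V) :
  continuous (fun x => k *: x - b).
Proof.
by move=> x; apply: cvgB; [exact: scaler_continuous | exact: cvg_cst].
Qed.

Lemma continuous_subX2 (R : realType) (T : topologicalType) (k : R) (f g : T -> R) :
  continuous f -> continuous g -> continuous (fun x => k * f x - g x ^+ 2).
Proof.
move=> cf cg x; under eq_fun do rewrite expr2.
apply: cvgB; last by apply: cvgM; exact: cg.
by apply: cvgM; [exact: cvg_cst | exact: cf].
Qed.

Lemma minkowski_diffP (R : realType) (n : nat) (K T : set 'rV[R]_n) x :
  minkowski_diff K T x <-> forall t, T t -> K (x + t).
Proof.
split=> [h t /h[y Ky <-]|h t Tt]; first by rewrite subrK.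
by exists (x + t); [exact: h | rewrite addrK].
Qed.

(** * Smooth normals *)

(** The range of [e] may depend on [v], which is enough for finitely many directions. The zero
    vector qualifies vacuously, so non-vanishing has to come from elsewhere, here from
    [dot a u != 0]. *)
Definition smooth_normal (R : realType) (n : nat) (K : set 'rV[R]_n)
    (a : 'rV[R]_n) : Prop :=
  exists p, (forall x, K x -> dot a x <= dot a p) /\
    (forall v, dot a v < 0 -> \forall e \near 0^'+, K (p + e *: v)).

Section SmoothNormal.
Variables (R : realType) (n : nat) (K : set 'rV[R]_n).
Hypothesis Kbody : convex_body K.

(** The homothety [f] of centre [x] and ratio [1 + d] sends this point to [q], hence a neighbourhood
    of it into [K]; and each [w] is a convex combination of [f w] and [x]. *)
Lemma interior_extend x q d : 0 < d -> K x -> K° q ->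
  K° ((1 + d)^-1 *: (q + d *: x)).
Proof.
have [_ Kcvx _] := Kbody => d0 Kx.
have d1 : 0 < 1 + d by rewrite ltr_wpDr ?ltW.
pose f (w : 'rV[R]_n) := (1 + d) *: w - d *: x.
have fE w : f ((1 + d)^-1 *: (w + d *: x)) = w.
  by rewrite /f scalerA mulfV ?gt_eqF// scale1r addrK.
move=> Kq; have cf : continuous f by exact: affine_continuous.
suff : nbhs ((1 + d)^-1 *: (q + d *: x)) (f @^-1` K).
  apply: filterS => w Kfw.
  have -> : w = (1 + d)^-1 *: f w + (1 - (1 + d)^-1) *: x.
    rewrite /f scalerBr !scalerA mulVf ?gt_eqF// scale1r -addrA -[LHS]addr0.
    congr (_ + _); rewrite addrC -scalerBl [X in X *: _](_ : _ = 0) ?scale0r//.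
    by field; rewrite gt_eqF.
  by apply: convex_combination => //; rewrite invr_ge0 ltW//= invf_le1// lerDl ltW.
by apply: cf; rewrite fE.
Qed.

Lemma exists_smooth_normal (u : 'rV[R]_n) : u != 0 ->
  exists2 a, smooth_normal K a & dot a u != 0.
Proof.
have [Kcpt Kcvx [c Kc]] := Kbody => u0.
have s0 := dot_gt0 u0; set s := dot u u in s0.
have [e e0 Ke] : exists2 e, 0 < e & forall w, dot w w < e ^+ 2 -> K° (c + w).
  have /nbhs_ballP[e /= e0 Ke] := open_nbhs_nbhs (conj (@open_interior _ K) Kc).
  exists e => // w we; apply: Ke; rewrite mx_norm_ball /ball_/= opprD addNKr normrN.
  by have := le_lt_trans (sqr_norm_le_dot w) we; have := normr_ge0 w; nra.
have [t t0 Kt] : exists2 t, 0 < t & ~ K (c + t *: u).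
  have [M [_ KM]] := compact_bounded Kcpt.
  have N0 : 0 < `|u| by rewrite normr_gt0.
  pose t := (`|M| + 1 + `|c|) / `|u| + 1.
  have t0 : 0 < t by rewrite ltr_wpDl// divr_ge0 ?addr_ge0.
  exists t => // /(KM (`|M| + 1)); rewrite /= => /(_ (ltr_pwDr ltr01 (ler_norm M))).
  apply/negP; rewrite -ltNge.
  apply: (@lt_le_trans _ _ (`|t *: u| - `|c|)); last first.
    by rewrite lerBlDl -{1}(addKr c (t *: u)) -[`|c|]normrN ler_normD.
  rewrite normrZ gtr0_norm// ltrBrDr /t mulrDl mul1r mulfVK ?gt_eqF//.
  by rewrite ltrDl.
(* This [m] makes [Q (t *: u)] smaller than [Q w] for every [w] orthogonal to
   [u] with [c + w] outside [K°]. *)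
pose m := e ^+ 2 / t ^+ 2.
have m0 : 0 < m by rewrite divr_gt0 ?exprn_gt0.
(* The sublevel sets of [Q] are the ellipsoids: [Q w] is [m * dot w w] along [u] and
   [(m + s) * dot w w] orthogonally to [u]. *)
pose Q (w : 'rV[R]_n) := (m + s) * dot w w - dot w u ^+ 2.
have Qge w : m * dot w w <= Q w.
  have := cauchy_schwarz w u0; rewrite -/s /Q; lra.
have cQ : continuous (fun x : 'rV[R]_n => Q (x - c)).
  have ct : continuous (fun x : 'rV[R]_n => x - c).
    rewrite (_ : (fun _ => _) = fun x => 1 *: x - c); first exact: affine_continuous.
    by apply/funext => x; rewrite scale1r.
  have cu : continuous (fun x : 'rV[R]_n => dot (x - c) u).
    by apply: continuous_dot => //; exact: cst_continuous.
  by apply: continuous_subX2 => //; exact: continuous_dot.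
(* The contact point is [c + z], where [z] minimises [Q] among the [w] with [c + w] outside [K°].
   Cutting at the level of [t *: u] makes the domain compact and keeps it non-empty. *)
have [z [Kz Qzt Qz]] : exists z, [/\ ~ K° (c + z), Q z <= Q (t *: u) &
    forall w, Q w < Q z -> K° (c + w)].
  pose A := ~` K° `&` (fun x : 'rV[R]_n => Q (x - c)) @^-1` [set r | r <= Q (t *: u)].
  have At : A (c + t *: u).
    by split; [move=> /interior_subset | rewrite /= addrC addKr].
  have Acpt : compact A.
    apply: bounded_closed_compact; last first.
      apply: closedI; first by apply: open_closedC; exact: open_interior.
      by apply: preimage_closed; [move=> x _; exact: cQ | exact: closed_le].
    exists (`|c| + (Q (t *: u) / m + 1)); split; first exact: num_real.
    move=> M ltM x [_ /= Qx]; apply: le_trans (ltW ltM).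
    have qx : `|x - c| ^+ 2 <= Q (t *: u) / m.
      rewrite ler_pdivlMr// mulrC; apply: le_trans Qx; apply: le_trans (Qge _).
      by rewrite ler_pM2l// sqr_norm_le_dot.
    rewrite -[x](addrNK c) addrC (le_trans (ler_normD _ _))// lerD2l.
    have := sqr_ge0 (`|x - c| - 1 / 2); lra.
  have [p /[!inE] -[Kp Qpt] minp] := @compact_EVT_min _ _ _ A
    (ex_intro _ _ At) Acpt (continuous_subspaceT cQ).
  exists (p - c); rewrite [c + _]addrC subrK; split=> // w Qw; apply: contrapT => Kw.
  have /minp : c + w \in A.
    by rewrite inE; split=> //=; rewrite addrC addKr; exact: le_trans (ltW Qw) Qpt.
  by rewrite (addrC c w) addrK leNgt Qw.
(* [a] is half the gradient of [Q] at [z]. *)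
pose p := c + z; pose a := (m + s) *: z - dot z u *: u.
have aE v : dot a v = (m + s) * dot z v - dot z u * dot u v.
  by rewrite /a dotDl dotNl !dotZl.
have near_p v : dot a v < 0 -> \forall r \near 0^'+, K° (p + r *: v).
  move=> av; have Qv0 : 0 <= Q v.
    by apply: le_trans (Qge v); rewrite mulr_ge0 ?dot_ge0 ?ltW.
  (* For [r] below this bound the linear term of [Q (z + r *: v)] outweighs the quadratic one; the
     [+ 1] keeps the denominator positive. *)
  have h : 0 < - dot a v / (Q v + 1) by rewrite divr_gt0 ?oppr_gt0// ltr_wpDl.
  near=> r; have r0 : 0 < r by near: r; exact: nbhs_right_gt.
  have : r < - dot a v / (Q v + 1) by near: r; exact: nbhs_right_lt.
  rewrite ltr_pdivlMr ?ltr_wpDl// => rlt.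
  rewrite /p -addrA; apply: Qz.
  have -> : Q (z + r *: v) = Q z + r * (2 * dot a v + r * Q v).
    rewrite aE /Q !(dotDl, dotDr, dotZl, dotZr) (dotC v z) (dotC u v); ring.
  by rewrite gtrDl pmulr_rlt0//; nra.
exists a; last first.
  rewrite aE -/s [X in X != 0](_ : _ = m * dot z u); last by ring.
  (* If [z] were orthogonal to [u], then [Q z] would be at least [(m + s) * e ^+ 2], above
     [Q (t *: u) = s * e ^+ 2]. *)
  rewrite mulf_eq0 (gt_eqF m0)/=; apply/eqP => zu.
  have : e ^+ 2 <= dot z z.
    by rewrite leNgt; apply/negP => /Ke.
  move: Qzt; rewrite /Q zu !(dotZl, dotZr) -/s.
  have : m * t ^+ 2 = e ^+ 2 by rewrite /m mulfVK// expf_neq0// gt_eqF.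
  have := exprn_gt0 2 e0; nra.
exists p; split=> [x Kx|v av]; last first.
  by apply: filterS (near_p v av) => r; exact: interior_subset.
(* Otherwise [p] lies strictly between [x] and an interior point of [K]. *)
rewrite leNgt; apply/negP => axp.
have apx : dot a (p - x) < 0 by rewrite dotDr dotNr subr_lt0.
have /filter_ex[d [Kd d0]] : \forall r \near 0^'+,
    K° (p + r *: (p - x)) /\ 0 < r.
  by apply: filterI; [exact: near_p | exact: nbhs_right_gt].
apply: Kz; have := interior_extend d0 Kx Kd.
suff -> : (1 + d)^-1 *: (p + d *: (p - x) + d *: x) = p by [].
rewrite scalerBr -addrA subrK -{1}[p]scale1r -scalerDl scalerA mulVf ?scale1r//.
by rewrite gt_eqF// ltr_wpDr// ltW.
Unshelve. all: by end_near. Qed.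

End SmoothNormal.

(** Rows are added one at a time: while there are fewer than [n], some [u != 0] is orthogonal to all
    of them, and a smooth normal not orthogonal to [u] lies outside their span. *)
Lemma exists_smooth_basis (R : realType) (n : nat) (K : set 'rV[R]_n) :
  convex_body K ->
  exists2 A : 'M[R]_n, A \in unitmx & forall i, smooth_normal K (row i A).
Proof.
move=> Kbody.
suff /(_ n (leqnn n))[A Afree Asmooth] : forall k, (k <= n)%N ->
    exists2 A : 'M[R]_(k, n), row_free A & forall i, smooth_normal K (row i A).
  by exists A; rewrite -?row_free_unit.
elim=> [_|k IH kn].
  by exists 0 => [|[]//]; rewrite /row_free mxrank0.
have [A Afree Asmooth] := IH (ltnW kn).
pose u := nz_row (kermx A^T).
have u0 : u != 0.
  rewrite nz_row_eq0 -mxrank_eq0 mxrank_ker mxrank_tr (eqP Afree).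
  by rewrite -lt0n subn_gt0.
have uA : A *m u^T = 0.
  apply: trmx_inj; rewrite trmx_mul trmxK trmx0; apply/sub_kermxP.
  exact: nz_row_sub.
have [a sa au] := exists_smooth_normal Kbody u0.
exists (col_mx a A : 'M[R]_(1 + k, n)) => [|i].
  apply: (@inj_row_free _ (1 + k)%N) => v; rewrite -[v]hsubmxK; move: (lsubmx v) (rsubmx v).
  move=> v1 v2; rewrite mul_row_col => v0.
  have v10 : v1 = 0.
    have /(congr1 (mulmx ^~ u^T)) := v0.
    rewrite mulmxDl -!mulmxA uA mulmx0 addr0 mul0mx dot_mulmx mul_mx_scalar.
    by move/eqP; rewrite scaler_eq0 (negPf au) => /eqP.
  move: v0; rewrite v10 mul0mx add0r => v2A.
  by rewrite (row_free_inj Afree (etrans v2A (esym (mul0mx _ A)))) row_mx0.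
move: i; change (forall i : 'I_(1 + k), smooth_normal K (row i (col_mx a A))) => i.
case: (split_ordP i) => j ->.
  rewrite rowKu ord1 (_ : row 0 a = a)//.
  by apply/rowP => l; rewrite mxE.
by rewrite rowKd.
Qed.

(** * The lower bound, from the dual basis *)

Lemma caratheodory_property_ge (R : realType) (n m : nat) (K : set 'rV[R]_n) :
  convex_body K -> caratheodory_property K m -> (n <= m)%N.
Proof.
case: n K => // n K Kbody Km; rewrite leqNgt; apply/negP => mn.
have [_ Kcvx _] := Kbody.
have [A Aunit Asmooth] := exists_smooth_basis Kbody.
have {Asmooth}/choice[p pP] i := Asmooth i.
pose x j := row j (invmx A)^T.
have Ax i j : dot (row i A) (x j) = (i == j)%:R.
  transitivity ((A *m invmx A) i j); last by rewrite mulmxV// mxE.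
  by rewrite mxE; apply: eq_bigr => k _; rewrite !mxE.
(* Half the weight of a point in the barycentre, so that [row i A] is larger on the barycentre than
   on [e *: (w *: x i)]. *)
pose w : R := (2 * n.+1%:R)^-1.
have w0 : 0 < w by rewrite invr_gt0 mulr_gt0.
(* One [e] serves finitely many directions. [Kij] gives, for each [i], a translate of [K] containing
   all [e *: x j] with [j != i]; [K0] gives one containing all of [X]. *)
have /filter_ex[e [e0 Kij K0]] : \forall e \near 0^'+, [/\ 0 < e,
    forall i j, j != i -> K (p i + e *: (x j - w *: x i)) &
    forall j, K (p ord0 + e *: (x j - 2 *: x ord0))].
  near=> e; split.
  - by near: e; exact: nbhs_right_gt.
  - near: e; apply: filter_forall => i; apply: filter_forall => j.
    case: (eqVneq j i) => ji; first by apply: nearW.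
    apply: filterS ((pP i).2 (x j - w *: x i) _) => [e Ke _//|].
    rewrite dotDr dotNr dotZr !Ax eqxx (eq_sym i) (negPf ji).
    by rewrite mulr1 sub0r oppr_lt0.
  - near: e; apply: filter_forall => j; apply: (pP ord0).2.
    rewrite dotDr dotNr dotZr !Ax eqxx mulr1.
    by case: (_ == _) => /=; lra.
pose X := range (fun j => e *: x j).
pose y := n.+1%:R^-1 *: \sum_j e *: x j.
have xinj : injective (fun j => e *: x j).
  move=> i j /(congr1 (dot (row i A))); rewrite !dotZr !Ax eqxx => /eqP.
  rewrite mulr1 -subr_eq0 -{1}(mulr1 e) -mulrBr mulf_eq0 gt_eqF//=.
  by case: (i =P j) => //= _; rewrite subr0 oner_eq0.
have hullX : strongly_convex_hull K X y.
  split; first by exists (e *: x ord0); exists ord0.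
  apply/minkowski_diffP => s /minkowski_diffP Ks.
  have -> : y + s = n.+1%:R^-1 *: \sum_(j < n.+1) (e *: x j + s).
    rewrite big_split/= scalerDr sumr_const card_ord -[s *+ _]scaler_nat scalerA.
    by rewrite mulVf ?pnatr_eq0// scale1r.
  apply: convex_mean => // j; rewrite addrC; apply: Ks.
  by exists j.
have Xfin : finite_set X by apply: finite_image; exact: finite_finset.
have Xtr : in_translate K X.
  exists (- (p ord0 - e *: (2 *: x ord0))) => _ [j _ <-].
  exists (p ord0 + e *: (x j - 2 *: x ord0)); first exact: K0.
  by rewrite scalerBr opprB (addrA _ (e *: (2 *: _))) -(addrA (p ord0)) subrK addrC addKr.
have := Km X Xfin Xtr; move: hullX => /[swap] -> [Y [YX Ym] [_ /minkowski_diffP yY]].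
(* [X] has [n.+1] distinct points and [Y] at most [m < n.+1]. *)
have [i Yi] : exists i, ~ Y (e *: x i).
  apply: contrapT => /forallNP YE.
  have : (`I_n.+1 #<= `I_m)%card.
    apply: card_le_trans Ym; rewrite (card_le_eql card_II).
    rewrite -(card_le_eql (inj_card_eq (in2W xinj))).
    by apply: subset_card_le => _ [i _ <-]; exact: contrapT (YE i).
  by rewrite card_le_II leqNgt mn.
have [pmax _] := pP i.
(* This shift moves [Y] into [K], hence also [y]; but [row i A] takes on the shifted [y] the value
   at [p i] plus [e * (2 * w) - e * w > 0], beyond its maximum on [K]. *)
have /yY/pmax : minkowski_diff K Y (p i - e *: (w *: x i)).
  apply/minkowski_diffP => t Yt; have [j _ tE] := YX _ Yt.
  have ji : j != i by apply: contra_not_neq Yi => <-; rewrite tE.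
  by rewrite -tE addrAC -addrA -scalerBr; exact: Kij.
rewrite /y dotDr !(dotDr, dotNr, dotZr) dot_sumr Ax eqxx.
rewrite (bigD1 i)//= big1 => [|j ji]; last first.
  by rewrite dotZr Ax eq_sym (negPf ji) mulr0.
rewrite dotZr Ax eqxx; apply/negP; rewrite -ltNge.
have -> : n.+1%:R^-1 = 2 * w by rewrite /w invfM mulVKf ?pnatr_eq0.
by rewrite !mulr1 addr0; nra.
Unshelve. all: by end_near. Qed.

Local Open Scope ereal_scope.

Theorem theorem1p8 (R : realType) (n : nat) (K : set 'rV[R]_n)
    (hK : convex_body K) :
  (n%:R)%:E <= caratheodory_number K.
Proof.
apply: le_ereal_inf_tmp => _ [m Km <-].
by rewrite lee_fin ler_nat; exact: caratheodory_property_ge Km.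
Qed.
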